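(* Let $\overline{\Omega}^1=\Omega\cup\partial^1\Omega$ be a compactification of $\Omega$ and let $f:\overline\Omega^1\to\mathbf R$ be continuous. Then $$\underline Wf=\underline P_{\Omega^1}f,\quad \overline Wf=\overline P_{\Omega^1}f,\quad \underline Zf=\underline S_{\Omega^1}f\quad\text{and}\quad \overline Zf=\overline S_{\Omega^1}f .$$ Moreover, $f|_\Omega$ is harmonizable if and only if $f|_{\partial^1\Omega}$ is resolutive, and when this happens $Wf=P_{\Omega^1}f$; and $f|_\Omega$ is Sobolev-harmonizable if and only if $f|_{\partial^1\Omega}$ is Sobolev-resolutive, and when this happens $Zf=S_{\Omega^1}f$.
   Context: Setting. $1<p<\infty$; $X=(X,d,\mu)$ is a complete metric space with a positive complete Borel measure $\mu$ such that $0<\mu(B)<\infty$ for all balls $B$ (balls are nonempty and open); $\mu$ is doubling ($\mu(B(x,2r))\le C\mu(B(x,r))$ for all $x,r$); $X$ supports a $(1,p)$-Poincaré inequality: there are $C>0$, $\lambda\ge1$ such that for all balls $B$, all integrable $f$ on $X$ and all upper gradients $g$ of $f$, $\frac1{\mu(B)}\int_B|f-f_B|\,d\mu\le C\,\mathrm{diam}(B)\bigl(\frac1{\mu(\lambda B)}\int_{\lambda B}g^p\,d\mu\bigr)^{1/p}$, where $f_B=\frac1{\mu(B)}\int_B f\,d\mu$. $\Omega\subset X$ is a nonempty bounded connected open set with $C_p(X\setminus\Omega)>0$. $\overline{\mathbf{R}}=[-\infty,\infty]$; $E\Subset\Omega$ means that $\overline E$ is a compact subset of $\Omega$. Function spaces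 (functions are defined everywhere, with values in $\overline{\mathbf R}$). A Borel function $g:X\to[0,\infty]$ is an upper gradient of $f:X\to\overline{\mathbf R}$ if $|f(\gamma(0))-f(\gamma(l_\gamma))|\le\int_\gamma g\,ds$ for all nonconstant compact rectifiable curves $\gamma:[0,l_\gamma]\to X$ (left side read as $\infty$ if one of the terms is infinite). A measurable $g$ is a $p$-weak upper gradient if this holds for all curves outside a family $\Gamma$ for which there is $0\le\rho\in L^p(X)$ with $\int_\gamma\rho\,ds=\infty$ for all $\gamma\in\Gamma$. $\|f\|_{N^{1,p}(X)}^p=\int_X|f|^p\,d\mu+\inf_g\int_X g^p\,d\mu$ (infimum over upper gradients $g$ of $f$); $N^{1,p}(X)$ is the set of measurable $f$ with finite norm; $D^p(X)$ is the set of measurable $f$ having an upper gradient in $L^p(X)$. $N^{1,p}(E)$, $D^p(E)$ for measurable $E\subset X$ are defined by regarding $(E,d|_E,\mu|_E)$ as the space. $g_f$ is the (a.e. unique) minimal $p$-weak upper gradient of $f$. $N^{1,p}_0(\Omega)=\{f|_\Omega: f\in N^{1,p}(X),\ f=0\text{ in }X\setminus\Omega\}$. $C_p(E)=\inf\|u\|_{N^{1,p}(X)}^p$ over $u\in N^{1,p}(X)$ with $u=1$ on $E$. Superharmonic functions. For nonempty open $G\subset\Omega$ and $f\in D^p(G)$, $H_Gf$ is the unique continuous function minimizing $\int_Gg_v^p\,d\mu$ among $v\in D^p(G)$ with $v-f\in N^{1,p}_0(G)$. $u:\Omega\to(-\infty,\infty]$ is superharmonic if it is lower semicontinuous, not identically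 $\infty$, and for every nonempty open $G\Subset\Omega$ and every Lipschitz function $v$ on $X$ with $v\le u$ on $\partial G$ one has $H_Gv\le u$ in $G$. Compactification. $\overline\Omega^1=\Omega\cup\partial^1\Omega$ (disjoint union) with topology $\tau^1$ is a compactification of $\Omega$ if it is compact Hausdorff, $\Omega$ is $\tau^1$-dense, and $\tau^1$ induces on $\Omega$ its given topology. $\Omega^1$ denotes $\Omega$ with the intended boundary $\partial^1\Omega$; $y\overset{\tau^1}{\to}x$ is convergence in $\tau^1$. (Sobolev–)Perron solutions. For $f:\partial^1\Omega\to\overline{\mathbf R}$, $\mathcal U_f(\Omega^1)$ is the set of superharmonic $u$ on $\Omega$, bounded from below, with $\liminf_{\Omega\ni y\overset{\tau^1}{\to}x}u(y)\ge f(x)$ for all $x\in\partial^1\Omega$; $\mathcal{DU}_f(\Omega^1)=\mathcal U_f(\Omega^1)\cap D^p(\Omega)$. For $x\in\Omega$, $\overline P_{\Omega^1}f(x)=\inf_{u\in\mathcal U_f(\Omega^1)}u(x)$, $\underline P_{\Omega^1}f=-\overline P_{\Omega^1}(-f)$, $\overline S_{\Omega^1}f(x)=\inf_{u\in\mathcal{DU}_f(\Omega^1)}u(x)$, $\underline S_{\Omega^1}f=-\overline S_{\Omega^1}(-f)$ ($\inf\emptyset=\infty$). $f$ is resolutive (Sobolev-resolutive) with respect to $\Omega^1$ if $\overline P_{\Omega^1}f=\underline P_{\Omega^1}f$ (resp. $\overline S_{\Omega^1}f=\underline S_{\Omega^1}f$) and this is real-valued; the common function is $P_{\Omega^1}f$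 (resp. $S_{\Omega^1}f$). For $f$ defined on $\overline\Omega^1$ these refer to $f|_{\partial^1\Omega}$. (Sobolev–)Wiener solutions. For $f:\Omega\to\overline{\mathbf R}$, $\mathcal U^W_f$ is the set of superharmonic $u$ in $\Omega$, bounded from below, for which there is a compact $K\subset\Omega$ with $u\ge f$ in $\Omega\setminus K$; $\mathcal{DU}^W_f=\mathcal U^W_f\cap D^p(\Omega)$. For $x\in\Omega$, $\overline Wf(x)=\inf_{u\in\mathcal U^W_f}u(x)$, $\underline Wf=-\overline W(-f)$, $\overline Zf(x)=\inf_{u\in\mathcal{DU}^W_f}u(x)$, $\underline Zf=-\overline Z(-f)$. $f$ is harmonizable (Sobolev-harmonizable) if $\overline Wf=\underline Wf$ (resp. $\overline Zf=\underline Zf$) and this is real-valued; the common function is $Wf$ (resp. $Zf$). For $f$ defined on $\overline\Omega^1$ these refer to $f|_\Omega$. *)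

(* Defs.v *)
From HB Require Import structures.
From mathcomp Require Import all_boot all_order all_algebra.
From mathcomp Require Import all_classical all_reals all_analysis measurable_realfun.

Set Implicit Arguments.
Unset Strict Implicit.
Unset Printing Implicit Defensive.

Import Order.TTheory GRing.Theory Num.Theory.
Import numFieldNormedType.Exports.

Local Open Scope classical_set_scope.
Local Open Scope ring_scope.
Local Open Scope ereal_scope.

(** Nonlinear potential theory on metric measure spaces.

    A function on a subset E of X with values in the extended reals is
    represented by a function f : X -> \bar R of which only the values on E
    matter.  A subset E regarded as a metric measure space of its own is
    represented by passing E to the definitions below: curves stay in E,
    integrals are over E, and measurability is relative to E. *)

#[short(type="completeMetricMeasurableType")]
HB.structure Definition CompleteMetricMeasurable
    (d : measure_display) (R : numDomainType) :=
  {X of Metric R X & Complete X & Measurable d X}.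

Section metric_measure_space.
Context {d : measure_display} {R : realType}
  {X : completeMetricMeasurableType d R}.
Implicit Types (mu : {measure set X -> \bar R}) (p : R) (E : set X)
  (f g : X -> \bar R) (gamma : R -> X).

Definition borel : set (set X) := <<s [set U : set X | open U] >>.

(** The Borel sets of the metric space E are the traces on E of those of X. *)
Definition borel_fun E g :=
  forall Y : set (\bar R), measurable Y ->
  exists2 B, borel B & E `&` g @^-1` Y = E `&` B.

(** The domain of the measure is the completion of the Borel sigma-algebra. *)
Definition complete_borel_measure mu :=
  [/\ forall A, borel A -> measurable A,
      measure_is_complete mu &
      forall A, measurable A -> exists B1 B2, [/\ borel B1, borel B2,
        B1 `<=` A, A `<=` B2 & mu (B2 `\` B1) = 0]].

Definition ball_measure_pos_fin mu :=
  forall (x : X) (r : R), (0 < r)%R ->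
  0 < mu (ball x r) /\ mu (ball x r) < +oo.

Definition doubling mu :=
  exists C : R, forall (x : X) (r : R), (0 < r)%R ->
  mu (ball x (2 * r)%R) <= C%:E * mu (ball x r).

Definition metric_bounded E := exists (x : X) (r : R), E `<=` ball x r.

Definition diam E : \bar R :=
  ereal_sup [set (mdist z.1 z.2)%:E | z in E `*` E].

Definition mean mu E f : \bar R :=
  ((fine (mu E))^-1)%:E * \int[mu]_(x in E) f x.

Definition curve_length gamma (a b : R) : \bar R :=
  ereal_sup [set (let F := gamma \o nth b (a :: s) in
                  \sum_(0 <= i < size s) mdist (F i) (F i.+1))%R%:E
            | s in itv_partition a b].

(** Nonconstant compact rectifiable curves in E, parametrized by arc length
    on [0, l]; the values of gamma outside [0, l] are irrelevant. *)
Definition arc_curve E (l : R) gamma :=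
  [/\ (0 < l)%R,
      forall t : R, (0 <= t <= l)%R -> E (gamma t) &
      forall s t : R, (0 <= s)%R -> (s <= t)%R -> (t <= l)%R ->
        curve_length gamma s t = (t - s)%:E].

(** When t |-> g (gamma t) is Lebesgue but not Borel measurable, this (a
    supremum of integrals of Borel simple functions below it) is still its
    Lebesgue integral. *)
Definition curve_int (l : R) gamma g : \bar R :=
  \int[lebesgue_measure]_(t in `[0%R, l]) g (gamma t).

(** [`|a - b|] is [+oo] in [\bar R] as soon as a or b is infinite, also when
    a = b. *)
Definition gradient_ineq f g (l : R) gamma :=
  `|f (gamma 0%R) - f (gamma l)| <= curve_int l gamma g.

Definition upper_gradient E f g :=
  [/\ borel_fun E g, forall x, E x -> 0 <= g x &
      forall l gamma, arc_curve E l gamma -> gradient_ineq f g l gamma].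

(** Every function in L^p(E) is dominated by, and a.e. equal to, a Borel one, so
    it makes no difference that rho is Borel. *)
Definition exceptional mu p E (Gamma : set (R * (R -> X))) :=
  exists rho : X -> \bar R,
    [/\ borel_fun E rho, forall x, E x -> 0 <= rho x,
        \int[mu]_(x in E) (rho x `^ p) < +oo &
        forall l gamma, arc_curve E l gamma -> Gamma (l, gamma) ->
          curve_int l gamma rho = +oo].

Definition weak_upper_gradient mu p E f g :=
  [/\ measurable_fun E g, forall x, E x -> 0 <= g x &
      exists2 Gamma, exceptional mu p E Gamma &
        forall l gamma, arc_curve E l gamma -> ~ Gamma (l, gamma) ->
          gradient_ineq f g l gamma].

Definition is_minimal_wug mu p E f g :=
  [/\ weak_upper_gradient mu p E f g,
      \int[mu]_(x in E) (g x `^ p) < +oo &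
      forall g', weak_upper_gradient mu p E f g' ->
        \int[mu]_(x in E) (g' x `^ p) < +oo ->
        {ae mu, forall x, E x -> g x <= g' x}].

(** The minimal p-weak upper gradient of f on E, for f in D^p(E). *)
Definition minimal_wug mu p E f : X -> \bar R :=
  xget (cst 0) [set g | is_minimal_wug mu p E f g].

(** The p-th power of the norm of N^{1,p}(E). *)
Definition newton_norm_pow mu p E f : \bar R :=
  \int[mu]_(x in E) (`|f x| `^ p) +
  ereal_inf [set \int[mu]_(x in E) (g x `^ p) | g in upper_gradient E f].

Definition newtonian mu p E f :=
  measurable_fun E f /\ newton_norm_pow mu p E f < +oo.

Definition dirichlet mu p E f :=
  measurable_fun E f /\
  exists2 g, upper_gradient E f g & \int[mu]_(x in E) (g x `^ p) < +oo.

(** N^{1,p}_0(G) *)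
Definition newtonian0 mu p (G : set X) f :=
  exists F : X -> \bar R, [/\ newtonian mu p setT F,
    forall x, ~ G x -> F x = 0 & forall x, G x -> F x = f x].

Definition capacity mu p E : \bar R :=
  ereal_inf [set newton_norm_pow mu p setT u |
    u in [set u | newtonian mu p setT u /\ forall x, E x -> u x = 1]].

Definition poincare mu p :=
  exists C lambda : R, [/\ (0 < C)%R, (1 <= lambda)%R &
    forall (x : X) (r : R), (0 < r)%R ->
    forall f g, mu.-integrable setT f -> upper_gradient setT f g ->
      mean mu (ball x r) (fun y => `|f y - mean mu (ball x r) f|) <=
      C%:E * diam (ball x r) *
      (mean mu (ball x (lambda * r)%R) (fun y => g y `^ p)) `^ p^-1].

Definition admissible mu p (G : set X) f v :=
  dirichlet mu p G v /\ newtonian0 mu p G (fun x => v x - f x).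

Definition energy mu p (G : set X) v : \bar R :=
  \int[mu]_(x in G) (minimal_wug mu p G v x `^ p).

(** h is H_G f.  The minimizer H_G f exists and is unique on G (for G a
    nonempty open subset of Omega and f in D^p(G)); off G, h is arbitrary. *)
Definition is_harmonic_ext mu p (G : set X) f (h : X -> R) :=
  [/\ {within G, continuous h}, admissible mu p G f (EFin \o h) &
      forall v, admissible mu p G f v ->
        energy mu p G (EFin \o h) <= energy mu p G v].

Definition lipschitz_fun (v : X -> R) :=
  exists L : R, forall x y, (`|v x - v y| <= L * mdist x y)%R.

Definition compactly_included E Omega :=
  compact (closure E) /\ closure E `<=` Omega.

Definition superharmonic mu p (Omega : set X) (u : X -> \bar R) :=
  [/\ forall x, Omega x -> -oo < u x,
      forall x (a : R), Omega x -> a%:E < u x ->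
        \forall y \near x, Omega y -> a%:E < u y,
      exists2 x, Omega x & u x != +oo &
      forall G : set X, G !=set0 -> open G -> compactly_included G Omega ->
      forall v : X -> R, lipschitz_fun v ->
        (forall x, (closure G `\` interior G) x -> (v x)%:E <= u x) ->
      forall h : X -> R, is_harmonic_ext mu p G (EFin \o v) h ->
      forall x, G x -> (h x)%:E <= u x].

Definition bounded_below (Omega : set X) (u : X -> \bar R) :=
  exists m : R, forall x, Omega x -> m%:E <= u x.

Section wiener.
Variables (mu : {measure set X -> \bar R}) (p : R) (Omega : set X).

Definition wiener_class f : set (X -> \bar R) :=
  [set u | [/\ superharmonic mu p Omega u, bounded_below Omega u &
     exists K : set X, [/\ compact K, K `<=` Omega &
       forall x, (Omega `\` K) x -> f x <= u x]]].

Definition sobolev_wiener_class f : set (X -> \bar R) :=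
  wiener_class f `&` dirichlet mu p Omega.

Definition upper_W f (x : X) : \bar R :=
  ereal_inf [set u x | u in wiener_class f].
Definition lower_W f (x : X) : \bar R := - upper_W (fun y => - f y) x.

Definition upper_Z f (x : X) : \bar R :=
  ereal_inf [set u x | u in sobolev_wiener_class f].
Definition lower_Z f (x : X) : \bar R := - upper_Z (fun y => - f y) x.

Definition harmonizable f := forall x, Omega x ->
  upper_W f x = lower_W f x /\ upper_W f x \is a fin_num.
Definition sobolev_harmonizable f := forall x, Omega x ->
  upper_Z f x = lower_Z f x /\ upper_Z f x \is a fin_num.

(** W f and Z f, the common values for (Sobolev-)harmonizable f. *)
Definition wiener_sol f : X -> \bar R := upper_W f.
Definition sobolev_wiener_sol f : X -> \bar R := upper_Z f.

End wiener.

Section perron.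
Variables (mu : {measure set X -> \bar R}) (p : R) (Omega : set X).

(** K is a compactification of Omega; iota, of which only the restriction to
    Omega matters, identifies Omega with a subset of K. *)
Definition is_compactification (K : topologicalType) (iota : X -> K) :=
  [/\ compact [set: K] /\ hausdorff_space K,
      dense (iota @` Omega),
      forall x y, Omega x -> Omega y -> iota x = iota y -> x = y &
      forall U : set X, U `<=` Omega ->
        (open U <-> exists2 V : set K, open V & U = Omega `&` iota @^-1` V)].

Variables (K : topologicalType) (iota : X -> K).
Implicit Types phi : K -> \bar R.

Definition ideal_boundary : set K := ~` (iota @` Omega).

(** The filter of y -> z with y in Omega, with respect to the topology of K. *)
Definition approach (z : K) : set_system X :=
  filter_from (nbhs z) (fun V => Omega `&` iota @^-1` V).

Definition perron_class phi : set (X -> \bar R) :=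
  [set u | [/\ superharmonic mu p Omega u, bounded_below Omega u &
     forall z, ideal_boundary z -> phi z <= limf_einf u (approach z)]].

Definition sobolev_perron_class phi : set (X -> \bar R) :=
  perron_class phi `&` dirichlet mu p Omega.

Definition upper_P phi (x : X) : \bar R :=
  ereal_inf [set u x | u in perron_class phi].
Definition lower_P phi (x : X) : \bar R := - upper_P (fun z => - phi z) x.

Definition upper_S phi (x : X) : \bar R :=
  ereal_inf [set u x | u in sobolev_perron_class phi].
Definition lower_S phi (x : X) : \bar R := - upper_S (fun z => - phi z) x.

Definition resolutive phi := forall x, Omega x ->
  upper_P phi x = lower_P phi x /\ upper_P phi x \is a fin_num.
Definition sobolev_resolutive phi := forall x, Omega x ->
  upper_S phi x = lower_S phi x /\ upper_S phi x \is a fin_num.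

(** P phi and S phi, the common values for (Sobolev-)resolutive phi. *)
Definition perron_sol phi : X -> \bar R := upper_P phi.
Definition sobolev_perron_sol phi : X -> \bar R := upper_S phi.

End perron.

End metric_measure_space.

(* Main.v *)
(** Since f is continuous on the compactification, the Wiener and Perron upper
    classes agree up to adding a positive constant.  A function that dominates
    f off a compact subset of Omega dominates it near every boundary point, so
    its lower limits there are at least f.  Conversely, if u lies in the Perron
    class and e > 0, then u + e >= f on the trace of a neighbourhood of the
    boundary, whose complement is a compact subset of Omega; and u + e is again
    superharmonic because adding a constant does not change upper gradients.
    The statements on lower solutions follow by applying this to - f. *)

Require Import Defs.
From HB Require Import structures.
From mathcomp Require Import all_boot all_order all_algebra.
From mathcomp Require Import all_classical all_reals all_analysis measurable_realfun.
From mathcomp Require Import ring lra.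

Set Implicit Arguments.
Unset Strict Implicit.
Unset Printing Implicit Defensive.

Import Order.TTheory GRing.Theory Num.Theory.
Import numFieldNormedType.Exports.

Local Open Scope classical_set_scope.
Local Open Scope ring_scope.

(** * Invariance of the potential theory under adding a real constant *)

Section translation.
Context {d : measure_display} {R : realType}
  {X : completeMetricMeasurableType d R}.
Variables (mu : {measure set X -> \bar R}) (p : R).
Implicit Types (f g u v : X -> \bar R) (c : R) (E G Omega : set X).

Definition translate c f : X -> \bar R := fun x => (f x + c%:E)%E.

Lemma translateK c f : translate (- c) (translate c f) = f.
Proof.
by apply/funext => x; rewrite /translate; case: (f x) => //= r; congr EFin; ring.
Qed.

Lemma translate_EFin c (h : X -> R) :
  translate c (EFin \o h) = EFin \o (fun x => h x + c).
Proof. by apply/funext => x. Qed.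

(** A real [c] leaves infinite values unchanged, so the identity survives whatever value is assigned
    to a difference of infinities. *)
Lemma sub_translate c (a b : \bar R) :
  ((a + c%:E) - (b + c%:E) = a - b)%E.
Proof.
by case: a b => [a| |] [b| |] //=; congr EFin; ring.
Qed.

Lemma gradient_ineq_translate c f :
  gradient_ineq (translate c f) = gradient_ineq f.
Proof.
apply/funext => g; apply/funext => l; apply/funext => gamma.
by rewrite /gradient_ineq /translate sub_translate.
Qed.

Lemma upper_gradient_translate E c f :
  upper_gradient E (translate c f) = upper_gradient E f.
Proof.
by apply/funext => g; rewrite /upper_gradient gradient_ineq_translate.
Qed.

Lemma weak_upper_gradient_translate E c f :
  weak_upper_gradient mu p E (translate c f) = weak_upper_gradient mu p E f.
Proof.
by apply/funext => g; rewrite /weak_upper_gradient gradient_ineq_translate.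
Qed.

(** Both sides choose by [xget] from the same set, so the two functions are equal everywhere, not
    just almost everywhere. *)
Lemma minimal_wug_translate E c f :
  minimal_wug mu p E (translate c f) = minimal_wug mu p E f.
Proof.
by rewrite /minimal_wug /is_minimal_wug weak_upper_gradient_translate.
Qed.

Lemma energy_translate G c v : energy mu p G (translate c v) = energy mu p G v.
Proof. by rewrite /energy minimal_wug_translate. Qed.

Lemma dirichlet_translate E c f :
  dirichlet mu p E f -> dirichlet mu p E (translate c f).
Proof.
move=> [mf grad_f]; split; last by rewrite upper_gradient_translate.
exact: emeasurable_funD.
Qed.

Lemma admissible_translate G c f v :
  admissible mu p G f v -> admissible mu p G (translate c f) (translate c v).
Proof.
move=> [Dv N0]; split; first exact: dirichlet_translate.
suff -> : (fun x => translate c v x - translate c f x)%E =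
          (fun x => v x - f x)%E by [].
by apply/funext => x; exact: sub_translate.
Qed.

Lemma is_harmonic_ext_translate G c f (h : X -> R) :
  is_harmonic_ext mu p G f h ->
  is_harmonic_ext mu p G (translate c f) (fun x => h x + c).
Proof.
move=> [ch ah minh]; split.
- by move=> x; apply: cvgD; [exact: ch | exact: cvg_cst].
- by rewrite -translate_EFin; exact: admissible_translate.
- move=> v av; rewrite -translate_EFin energy_translate.
  (* Shifting a competitor [v] back by [- c] gives a competitor of the same energy for the original
     boundary data. *)
  rewrite -(energy_translate G (- c) v); apply: minh.
  by rewrite -(translateK c f); exact: admissible_translate.
Qed.

Lemma lipschitz_fun_translate c (v : X -> R) :
  lipschitz_fun v -> lipschitz_fun (fun x => v x + c).
Proof.
move=> [L vL]; exists L => x y.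
by rewrite opprD addrACA subrr addr0.
Qed.

Lemma superharmonic_translate Omega c u :
  superharmonic mu p Omega u -> superharmonic mu p Omega (translate c u).
Proof.
move=> [uNy lsc [x0 Ox0 ux0] comparison]; split.
- by move=> x /uNy; rewrite /translate; case: (u x) => // *; rewrite ltNyr.
- move=> x a Ox; rewrite /translate -lteBlDr// -EFinB => /(lsc _ _ Ox).
  by apply: filterS => y uy Oy; rewrite -lteBlDr// -EFinB; exact: uy.
- by exists x0 => //; rewrite /translate; case: (u x0) ux0.
- move=> G G0 oG GO v Lv vu h hh x Gx.
  have : ((h x - c)%:E <= u x)%E.
    (* The test function and its harmonic extension are both lowered by [c], so that the comparison
       property of [u] itself applies. *)
    apply: (comparison G G0 oG GO (fun y => v y - c) _ _ (fun y => h y - c)) => //.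
    + exact: lipschitz_fun_translate.
    + by move=> y /vu; rewrite /translate EFinB leeBlDr.
    + by rewrite -translate_EFin; exact: is_harmonic_ext_translate.
  by rewrite /translate EFinB leeBlDr.
Qed.

Lemma bounded_below_translate Omega c u :
  bounded_below Omega u -> bounded_below Omega (translate c u).
Proof.
by move=> [m um]; exists (m + c) => x Ox; rewrite EFinD leeD2r// um.
Qed.

End translation.

(** * Closed and compact sets in a compactification *)

Section compactification.
Context {d : measure_display} {R : realType}
  {X : completeMetricMeasurableType d R}.
Variables (Omega : set X) (K : topologicalType) (iota : X -> K).
Hypothesis hK : is_compactification Omega iota.

Lemma open_preimage_compactification (V : set K) :
  open V -> open (Omega `&` iota @^-1` V).
Proof.
have [_ _ _ emb] := hK; move=> oV.
by apply/(emb _ (@subIsetl _ _ _)); exists V.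
Qed.

(** On [C] the map [iota] is continuous, so the image is compact, hence closed in a Hausdorff
    space. *)
Lemma closed_image_compactification (C : set X) :
  compact C -> C `<=` Omega -> closed (iota @` C).
Proof.
move=> cC CO; apply: compact_closed; first by have [[_ ?] _ _ _] := hK.
apply: continuous_compact => //; apply: continuous_in_subspaceT => x.
rewrite inE => /CO Ox V; rewrite nbhsE/= => -[W [oW Wx] WV].
apply: (filterS _ (open_nbhs_nbhs (conj (open_preimage_compactification oW) _))).
  by move=> y [_ /WV].
by split.
Qed.

(** The image of a filter on the preimage clusters at some [iota x] in the compact set [L]; since
    [iota] embeds [Omega], the filter itself clusters at [x]. *)
Lemma compact_preimage_compactification (L : set K) :
  open Omega -> closed L -> L `<=` iota @` Omega -> compact (Omega `&` iota @^-1` L).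
Proof.
have [[cK _] _ _ emb] := hK; move=> hopen clL LO F FF FC.
have cL : compact L by exact: (subclosed_compact clL cK).
have FL : (iota @ F) L.
  by apply: (@filterS _ F _ _ (iota @^-1` L) _ FC); exact: subIsetr.
have [k [Lk clk]] := cL _ (fmap_proper_filter iota FF) FL.
have [x Ox xk] := LO _ Lk.
exists x; split; first by split => //=; rewrite xk.
move=> A B FA; rewrite nbhsE/= => -[W [oW Wx] WB].
(* Only open subsets of [Omega] are traces of open sets of [K], so [W] is first cut down to
   [Omega]. *)
have /(emb _ (@subIsetl _ _ _)) [V oV WV] : open (Omega `&` W) by exact: openI.
have [_ Vx] : (Omega `&` iota @^-1` V) x by rewrite -WV.
(* Keeping [Omega] in this set ensures that the point [y] found below lies in [Omega], where [iota]
   is controlled. *)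
have FAC : (iota @ F) (iota @` (A `&` (Omega `&` iota @^-1` L))).
  have /filterS : A `&` (Omega `&` iota @^-1` L) `<=`
      iota @^-1` (iota @` (A `&` (Omega `&` iota @^-1` L))).
    exact: preimage_image.
  by apply; exact: filterI.
have nV : nbhs k V by rewrite -xk; exact: open_nbhs_nbhs.
have [_ [[y [Ay [Oy _]] <-] Vy]] := clk _ _ FAC nV.
exists y; split => //.
have [_ Wy] : (Omega `&` W) y by rewrite WV.
exact: WB.
Qed.

End compactification.

(** The loss [e] appears because the supremum defining the lower limit need not be attained. *)
Lemma le_limf_einfP (R : realType) (T : choiceType) (Y : filteredType T)
    (u : Y -> \bar R) (F : set_system Y) (a : R) :
  (a%:E <= limf_einf u F)%E <-> forall e : R, 0 < e ->
    exists2 V, F V & forall x, V x -> ((a - e)%:E <= u x)%E.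
Proof.
rewrite limf_einfE; split=> [au e e0|au].
  have /ereal_sup_gt [_ [V FV <-] aV] :
      ((a - e)%:E < ereal_sup [set ereal_inf (u @` V) | V in F])%E.
    by apply: lt_le_trans au; rewrite lte_fin ltrBlDr ltrDl.
  exists V => // x Vx; apply: (le_trans (ltW aV)).
  by apply: ereal_inf_lbound; exists x.
apply/lee_addgt0Pr => e /au [V FV Vu]; rewrite -leeBlDr// -EFinB.
apply: (@le_trans _ _ (ereal_inf (u @` V))).
  by apply: le_ereal_inf_tmp => _ [x /Vu ? <-].
by apply: ereal_sup_ubound; exists V.
Qed.

(** * Comparison of the Wiener and Perron upper classes *)

Section wiener_perron.
Context {d : measure_display} {R : realType}
  {X : completeMetricMeasurableType d R}.
Variables (mu : {measure set X -> \bar R}) (p : R).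
Variables (Omega : set X) (K : topologicalType) (iota : X -> K).
Hypothesis hopen : open Omega.
Hypothesis hK : is_compactification Omega iota.
Variable f : K -> R.
Hypothesis hf : continuous f.

Let fOmega : X -> \bar R := fun x => (f (iota x))%:E.
Let fbdry : K -> \bar R := fun z => (f z)%:E.

Lemma sub_wiener_perron_class :
  wiener_class mu p Omega fOmega `<=` perron_class mu p Omega iota fbdry.
Proof.
move=> u [su bu [C [cC CO fu]]]; split => // z bz.
apply/le_limf_einfP => e e0.
have nC : nbhs z (~` (iota @` C)).
  apply: open_nbhs_nbhs; split; last first.
    by move=> [x /CO Ox xz]; apply: bz; exists x.
  by apply: closed_openC; exact: (closed_image_compactification hK).
have nf : nbhs z [set k | f z - e < f k].
  by apply: (cvgr_gt (f z) (@hf z)); rewrite ltrBlDr ltrDl.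
exists (Omega `&` iota @^-1` (~` (iota @` C) `&` [set k | f z - e < f k])).
  by eexists; [exact: filterI nC nf|].
move=> x [Ox [/= Cx fx]]; apply: (@le_trans _ _ (fOmega x)).
  by rewrite lee_fin ltW.
by apply: fu; split => // ?; apply: Cx; exists x.
Qed.

Lemma perron_class_translate e u : 0 < e ->
  perron_class mu p Omega iota fbdry u ->
  wiener_class mu p Omega fOmega (translate e u).
Proof.
move=> e0 [su bu lu]; split.
- exact: superharmonic_translate.
- exact: bounded_below_translate.
(* The condition is vacuous at ideal boundary points, so it makes sense on all of [K]; taking the
   interior makes the complement of [V] closed. *)
pose V := [set k | forall x, Omega x -> iota x = k ->
                             (fOmega x <= translate e u x)%E]°.
have bV : ideal_boundary Omega iota `<=` V.
  (* One half of [e] absorbs the loss in the lower limit of [u], the other the variation of [f] near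
     [z]. *)
  move=> z bz; have e2 : 0 < e / 2 by rewrite divr_gt0.
  have [W [W' nW' W'W] Wu] := (le_limf_einfP _ _ _).1 (lu z bz) _ e2.
  have nf : nbhs z [set k | f k < f z + e / 2].
    by apply: (cvgr_lt (f z) (@hf z)); rewrite ltrDl.
  apply: (filterS _ (filterI nW' nf)) => k [W'k fk] x Ox xk.
  have /Wu : W x by apply: W'W; split => //=; rewrite xk.
  rewrite /translate -leeBlDr// /fOmega -EFinB xk; apply: le_trans.
  by rewrite lee_fin; move: fk; rewrite /mkset; lra.
exists (Omega `&` iota @^-1` (~` V)); split.
- apply: (compact_preimage_compactification hK hopen).
    by apply: open_closedC; exact: open_interior.
  by rewrite -[X in _ `<=` X]setCK; exact: subsetC.
- exact: subIsetl.
- move=> x [Ox nVx]; have /interior_subset : V (iota x).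
    by apply: contrapT => ?; apply: nVx.
  exact.
Qed.

Lemma upper_W_eq_upper_P x :
  upper_W mu p Omega fOmega x = upper_P mu p Omega iota fbdry x.
Proof.
apply/eqP; rewrite eq_le; apply/andP; split; last first.
  by apply: ereal_inf_le_tmp; apply: image_subset; exact: sub_wiener_perron_class.
(* Each Perron competitor yields a Wiener competitor larger by [e], and [e] is arbitrary. *)
apply: le_ereal_inf_tmp => _ [u Pu <-]; apply/lee_addgt0Pr => e e0.
apply: ereal_inf_lbound; exists (translate e u) => //.
exact: perron_class_translate.
Qed.

Lemma upper_Z_eq_upper_S x :
  upper_Z mu p Omega fOmega x = upper_S mu p Omega iota fbdry x.
Proof.
apply/eqP; rewrite eq_le; apply/andP; split; last first.
  apply: ereal_inf_le_tmp; apply: image_subset => u [Wu Du]; split => //.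
  exact: sub_wiener_perron_class.
apply: le_ereal_inf_tmp => _ [u [Pu Du] <-]; apply/lee_addgt0Pr => e e0.
apply: ereal_inf_lbound; exists (translate e u) => //.
by split; [exact: perron_class_translate | exact: dirichlet_translate].
Qed.

End wiener_perron.

Theorem theorem8p9 (d : measure_display) (R : realType)
  (X : completeMetricMeasurableType d R) (mu : {measure set X -> \bar R})
  (p : R) (hp : 1 < p)
  (hmu : complete_borel_measure mu) (hball : ball_measure_pos_fin mu)
  (hdoubling : doubling mu) (hpoincare : poincare mu p)
  (Omega : set X) (hne : Omega !=set0) (hbdd : metric_bounded Omega)
  (hconn : connected Omega) (hopen : open Omega)
  (hcap : (0 < capacity mu p (~` Omega))%E)
  (K : topologicalType) (iota : X -> K)
  (hK : is_compactification Omega iota)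
  (f : K -> R) (hf : continuous f) :
  let fOmega : X -> \bar R := fun x => (f (iota x))%:E in
  let fbdry : K -> \bar R := fun z => (f z)%:E in
  [/\ forall x, Omega x ->
        lower_W mu p Omega fOmega x = lower_P mu p Omega iota fbdry x,
      forall x, Omega x ->
        upper_W mu p Omega fOmega x = upper_P mu p Omega iota fbdry x,
      forall x, Omega x ->
        lower_Z mu p Omega fOmega x = lower_S mu p Omega iota fbdry x &
      forall x, Omega x ->
        upper_Z mu p Omega fOmega x = upper_S mu p Omega iota fbdry x]
  /\
  [/\ harmonizable mu p Omega fOmega <-> resolutive mu p Omega iota fbdry,
      harmonizable mu p Omega fOmega -> forall x, Omega x ->
        wiener_sol mu p Omega fOmega x = perron_sol mu p Omega iota fbdry x,
      sobolev_harmonizable mu p Omega fOmega <->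
        sobolev_resolutive mu p Omega iota fbdry &
      sobolev_harmonizable mu p Omega fOmega -> forall x, Omega x ->
        sobolev_wiener_sol mu p Omega fOmega x =
        sobolev_perron_sol mu p Omega iota fbdry x].
Proof.
move=> fOmega fbdry.
have hNf : continuous (fun k => - f k) by move=> k; apply: cvgN; exact: hf.
have WP x : upper_W mu p Omega fOmega x = upper_P mu p Omega iota fbdry x.
  exact: upper_W_eq_upper_P.
have ZS x : upper_Z mu p Omega fOmega x = upper_S mu p Omega iota fbdry x.
  exact: upper_Z_eq_upper_S.
have lWP x : lower_W mu p Omega fOmega x = lower_P mu p Omega iota fbdry x.
  (* The negatives of [fOmega] and [fbdry] are, by computation, the functions built from [- f]. *)
  by congr (- _)%E; exact: (upper_W_eq_upper_P mu p hopen hK hNf).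
have lZS x : lower_Z mu p Omega fOmega x = lower_S mu p Omega iota fbdry x.
  by congr (- _)%E; exact: (upper_Z_eq_upper_S mu p hopen hK hNf).
split; first by split.
split.
- by split=> H x Ox; [rewrite -WP -lWP|rewrite WP lWP]; exact: H.
- by move=> _ x _; exact: WP.
- by split=> H x Ox; [rewrite -ZS -lZS|rewrite ZS lZS]; exact: H.
- by move=> _ x _; exact: ZS.
Qed.
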